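(* Let $(X,\mathcal{A},\mu)$ be a measure space and let $M$ be a maximal ideal in $\mathcal{M}(X,\mathcal{A})$ containing a $Z_\mu$-ideal $I$. Then $M$ is a $Z_\mu$-ideal. In particular, a maximal $Z_\mu$-ideal in $\mathcal{M}(X,\mathcal{A})$ (i.e. a maximal element, with respect to inclusion, of the set of proper $Z_\mu$-ideals) is a maximal ideal.
   Context: $X$ is a non-empty set, $\mathcal{A}$ a $\sigma$-algebra on $X$, $\mu:\mathcal{A}\to[0,\infty]$ a measure. $\mathcal{M}(X,\mathcal{A})$ is the commutative ring of all measurable functions $X\to\mathbb{R}$ under pointwise operations. $Z(f)=\{x\in X: f(x)=0\}$ and $Z[I]=\{Z(f): f\in I\}$. An ideal $I$ of $\mathcal{M}(X,\mathcal{A})$ is a $Z_\mu$-ideal if whenever $f\in\mathcal{M}(X,\mathcal{A})$ vanishes $\mu$-almost everywhere on some $Z\in Z[I]$ (i.e. $\mu(Z\setminus Z(f))=0$), then $f\in I$; equivalently, whenever $f\in\mathcal{M}(X,\mathcal{A})$ equals some $g\in I$ $\mu$-almost everywhere on $X$, then $f\in I$. *)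

(* Defs.v *)
From HB Require Import structures.
From mathcomp Require Import all_boot all_order all_algebra.
From mathcomp Require Import all_classical all_reals all_analysis.
From mathcomp Require Import measurable_realfun.

Set Implicit Arguments.
Unset Strict Implicit.
Unset Printing Implicit Defensive.

Import Order.TTheory GRing.Theory Num.Theory.
Local Open Scope classical_set_scope.
Local Open Scope ring_scope.

(* Subsets of a ring are predicates {pred A}, as in ring_quotient; classically
   these are all the subsets. *)

(* An ideal, possibly improper: a submodule of A over itself. The library's
   idealr_closed adds the condition 1 \notin I, i.e. it describes the proper
   ideals. *)
Definition is_ideal (A : comNzRingType) (I : {pred A}) : Prop :=
  GRing.submod_closed (I : {pred A^o}).

Definition maximal_ideal (A : comNzRingType) (M : {pred A}) : Prop :=
  idealr_closed M /\
  forall J : {pred A}, idealr_closed J -> {subset M <= J} -> J =i M.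

(* M(X, A) is the ring {mfun X >-> R} of functions measurable for the Borel
   sigma-algebra of R. X is non-empty because every measurableType is
   pointed. *)

Definition zero_set (d : measure_display) (X : measurableType d)
    (R : realType) (f : {mfun X >-> R}) : set X :=
  [set x | f x = 0].

Definition zero_sets (d : measure_display) (X : measurableType d)
    (R : realType) (I : {pred {mfun X >-> R}}) : set (set X) :=
  [set zero_set f | f in [set` I]].

Definition Zmu_ideal (d : measure_display) (X : measurableType d)
    (R : realType) (mu : {measure set X -> \bar R})
    (I : {pred {mfun X >-> R}}) : Prop :=
  is_ideal I /\
  forall (f : {mfun X >-> R}) (Z : set X), zero_sets I Z ->
    mu (Z `\` zero_set f) = 0%E -> f \in I.

Definition maximal_Zmu_ideal (d : measure_display) (X : measurableType d)
    (R : realType) (mu : {measure set X -> \bar R})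
    (M : {pred {mfun X >-> R}}) : Prop :=
  [/\ idealr_closed M, Zmu_ideal mu M &
      forall J : {pred {mfun X >-> R}}, idealr_closed J -> Zmu_ideal mu J ->
        {subset M <= J} -> J =i M].

(* Main.v *)
Require Import Defs.
From HB Require Import structures.
From mathcomp Require Import all_boot all_order all_algebra.
From mathcomp Require Import all_classical all_reals all_analysis.
From mathcomp Require Import measurable_realfun.

(** A [Z_mu]-ideal contains [0], hence the indicator of every measurable null
    set. If [h] lies in an ideal [J] containing these indicators and [f]
    vanishes on the zero set of [h] outside a null set [E], then
    [f = f * 1_E + (f / h) * h] with the convention [1 / 0 = 0], so [f] lies in
    [J]. Thus every ideal above a [Z_mu]-ideal is a [Z_mu]-ideal, maximal or
    not, and a maximal [Z_mu]-ideal has no proper ideal strictly above it. *)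

Import GRing.Theory.

Local Open Scope classical_set_scope.
Local Open Scope ring_scope.

(** Inversion is discontinuous at [0], where its value is [0] by convention, so the line is cut
    there: every function is measurable on a singleton, and inversion is continuous on the open
    complement. *)
Lemma measurable_inv (R : realType) :
  measurable_fun [set: R] (GRing.inv : R -> R).
Proof.
have m0 : measurable [set 0 : R] by exact: measurable_set1.
rewrite -(setUv [set 0 : R]); apply/measurable_funU => //.
  exact: measurableC.
split; first exact: measurable_fun_set1.
apply: open_continuous_measurable_fun.
  rewrite (_ : ~` _ = [set x | x != 0]); first exact: open_neq.
  by apply/seteqP; split=> x /= /eqP.
by move=> x /set_mem /eqP x0; exact: inv_continuous.
Qed.

Section Zmu_ideals.
Context (d : measure_display) (X : measurableType d) (R : realType).
Implicit Types (mu : {measure set X -> \bar R}) (f : {mfun X >-> R}).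

Lemma measurable_zero_set f : measurable (zero_set f).
Proof. exact: measurable_funPTI (measurable_set1 0). Qed.

Lemma mfun_inv_proof f : measurable_fun [set: X] (fun x => (f x)^-1).
Proof. exact: measurableT_comp (measurable_inv R) (measurable_funPT f). Qed.

Definition mfun_inv f : {mfun X >-> R} :=
  HB.pack (fun x => (f x)^-1)
    (isMeasurableFun.Build d _ X R (fun x => (f x)^-1) (mfun_inv_proof f)).

Lemma indic_mfunE (E : set X) (mE : measurable E) (x : X) :
  indic_mfun (rT := R) E mE x = (x \in E)%:R.
Proof. exact: indicE. Qed.

Lemma Zmu_ideal_indic mu (I : {pred {mfun X >-> R}}) (E : set X)
    (mE : measurable E) :
  Zmu_ideal mu I -> mu E = 0%E -> indic_mfun E mE \in I.
Proof.
(* [setT] is the zero set of [0], which lies in [I]; the set that must be null is then the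
   complement of the zero set of the indicator, which is [E] itself. *)
move=> [[I0 _] ZI] muE; apply: (ZI _ setT).
  by exists 0; [exact: I0 | apply/seteqP; split].
rewrite setTD (_ : ~` _ = E)//; apply/seteqP; split=> x /=.
  move=> xE; apply: contrapT => nEx; apply: xE.
  by rewrite /zero_set/= indic_mfunE memNset.
by move=> Ex /eqP; rewrite indic_mfunE mem_set// oner_eq0.
Qed.

Lemma Zmu_idealS mu (I J : {pred {mfun X >-> R}}) :
  is_ideal J -> Zmu_ideal mu I -> {subset I <= J} -> Zmu_ideal mu J.
Proof.
move=> idJ ZI IJ; split=> // f _ [h hJ <-] muE.
have mE : measurable (zero_set h `\` zero_set f).
  by apply: measurableD; exact: measurable_zero_set.
have /IJ EJ := Zmu_ideal_indic _ _ _ mE ZI muE.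
case: idJ => J0 linJ.
have mulJ (a u : {mfun X >-> R}) : u \in J -> a * u \in J.
  by move=> uJ; rewrite -[a * u]addr0; exact: linJ.
have -> : f = f * indic_mfun _ mE + f * mfun_inv h * h.
  apply/mfuneqP => x.
  rewrite -[RHS]/(f x * indic_mfun _ mE x + f x * (h x)^-1 * h x) indic_mfunE.
  (* Off the zero set of [h] the indicator is [0] and [h x] cancels. On it the second summand
     vanishes, and the indicator is [1] unless [f x = 0], when both sides are [0]. *)
  have [hx0|hx0] := eqVneq (h x) 0; last first.
    rewrite memNset ?mulr0 ?add0r ?mulfVK//.
    by move=> [/eqP]; rewrite (negbTE hx0).
  have [fx0|fx0] := eqVneq (f x) 0; first by rewrite fx0 !mul0r addr0.
  by rewrite hx0 mulr0 addr0 mem_set ?mulr1//; split=> //; exact/eqP.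
exact: linJ EJ (mulJ _ _ hJ).
Qed.

End Zmu_ideals.

Lemma idealr_closed_is_ideal (A : comNzRingType) (I : {pred A}) :
  idealr_closed I -> is_ideal I.
Proof. by case. Qed.

Theorem corollary5p4 (d : measure_display) (X : measurableType d)
    (R : realType) (mu : {measure set X -> \bar R}) :
  (forall M I : {pred {mfun X >-> R}},
      maximal_ideal M -> Zmu_ideal mu I -> {subset I <= M} ->
      Zmu_ideal mu M) /\
  (forall M : {pred {mfun X >-> R}},
      maximal_Zmu_ideal mu M -> maximal_ideal M).
Proof.
split=> [M I [/idealr_closed_is_ideal idM _]|M [idM ZM maxM]].
  exact: Zmu_idealS.
split=> // J idJ MJ; apply: maxM => //.
(* [J] is a [Z_mu]-ideal because it lies above [M], so it competes in the maximality of [M]. *)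
by apply: (Zmu_idealS _ _ _ _ M) => //; exact: idealr_closed_is_ideal.
Qed.
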